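(* Let $q=p^s$ with $p$ an odd prime, let $n$ be a positive integer, let $\lambda\in\mathbb{F}_{q^n}$, and let $\mathcal C_1$ be the curve $y^q-y=x^{q+1}-x^2-\lambda$. Then $\mathcal C_1$ is minimal in $\mathbb{F}_{q^n}$ if and only if one of the following holds: (a) $\mathrm{Tr}(\lambda)=0$, $2p$ divides $n$ and $q\equiv 1\pmod 4$; (b) $\mathrm{Tr}(\lambda)=0$, $4p$ divides $n$ and $q\equiv 3\pmod 4$. Moreover, $\mathcal C_1$ is maximal in $\mathbb{F}_{q^n}$ if and only if $\mathrm{Tr}(\lambda)=0$, $2p$ divides $n$, $4$ does not divide $n$ and $q\equiv 3\pmod 4$.
   Context: $\mathrm{Tr}:\mathbb{F}_{q^n}\to\mathbb{F}_q$ is the trace map. Let $N_n(\mathcal C_1)$ be the number of pairs $(x,y)\in\mathbb{F}_{q^n}^2$ on the affine curve $\mathcal C_1$. The curve has genus $g=q(q-1)/2$, and the Hasse–Weil bound reads $|N_n(\mathcal C_1)-q^n|\le 2g\,q^{n/2}=(q-1)q^{(n+2)/2}$. The curve is called maximal (resp. minimal) in $\mathbb{F}_{q^n}$ if $N_n(\mathcal C_1)=q^n+(q-1)q^{(n+2)/2}$ (resp. $N_n(\mathcal C_1)=q^n-(q-1)q^{(n+2)/2}$), i.e. it attains the upper (resp. lower) Hasse–Weil bound. *)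

(* Defs.v *)
From mathcomp Require Export all_boot all_order all_fingroup all_algebra all_field.

Set Implicit Arguments.
Unset Strict Implicit.
Unset Printing Implicit Defensive.

Import GRing.Theory Num.Theory.
Local Open Scope ring_scope.

(* K plays the role of F_q and L of F_(q^n), with n = \dim {:L}.
   [finvect_type L] is the field L itself, equipped with the finite type and
   splitting field structures it has as a finite extension of a finite field. *)
Section Curve.
Variables (K : finFieldType) (L : fieldExtType K).

(* The values lie in the copy 1%VS of K inside L. *)
Definition fftrace (a : finvect_type L) : finvect_type L :=
  galTrace 1%VS {:finvect_type L}%VS a.

(* The affine L-points of y^q - y = x^(q+1) - x^2 - lambda, q = #|K|. *)
Definition curve_points (lambda : finvect_type L) :
    {set finvect_type L * finvect_type L} :=
  [set P | P.2 ^+ #|K| - P.2 == P.1 ^+ #|K|.+1 - P.1 ^+ 2 - lambda].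

(* (q - 1) q^((n+2)/2) = 2 g q^(n/2) with g = q (q - 1) / 2; it is taken in
   algC, with half-integral powers of q when n is odd. *)
Definition hasse_weil_radius : algC :=
  (#|K|%:R - 1) * sqrtC #|K|%:R ^+ (\dim {:L}%VS + 2).

Definition maximal_curve (lambda : finvect_type L) : Prop :=
  #|curve_points lambda|%:R = #|K|%:R ^+ \dim {:L}%VS + hasse_weil_radius.

Definition minimal_curve (lambda : finvect_type L) : Prop :=
  #|curve_points lambda|%:R = #|K|%:R ^+ \dim {:L}%VS - hasse_weil_radius.

End Curve.

(* Main.v *)
(* Let F = F_(q^n) and tr its trace to F_q. Since
     -2 tr(x^(q+1) - x^2) = tr((x^q - x)^2)
   and x |-> x^q - x is q-to-one onto the trace zero elements, the curve has
   q^2 M(c) points, where c = -2 tr(lambda) and M(c) ([count0 c]) counts the y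
   with tr y = 0 and tr(y^2) = c.  Put e(c) = q M(c) - q^(n-1) ([deviation c]);
   the curve is extremal iff e(c) = +- (q-1) q^(n/2).
   - The sum of e(c)^2 over F_q follows from counting the pairs (u, v) of trace
     zero elements with tr(u v) = 0; if p does not divide n it is already
     smaller than (q-1)^2 q^n.
   - If p | n, then e(c) = q T(c) - q^n, where T(c) ([count2 c]) counts
     the y with tr(y^2) = c.
   - If moreover n is odd, a nonsquare of F_q stays a nonsquare in F, whence
     e(g c) = - e(c) for such g: e(0) = 0 and e^2 is constant on c <> 0, so the
     value of the sum of squares excludes extremality.
   - If moreover n = 2 m and Q = q^m, then tr(y^2) is the trace from F_Q of
     y^2 + y^(2 Q); every nonzero element of F_Q is hit equally often by
     y |-> y^2 + y^(2 Q), and the zeros are the roots of y^(2 (Q-1)) = -1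
     together with 0, which exist in F iff Q = 3 mod 4.  This gives e(c)
     exactly. *)
Require Import Defs.
From mathcomp Require Import ring lra zify.

Set Implicit Arguments.
Unset Strict Implicit.
Unset Printing Implicit Defensive.

Import GRing.Theory Num.Theory Order.TTheory.
Local Open Scope ring_scope.

(** * Counting by fibres and by roots of polynomials *)

Lemma odd_mod4 k : odd k -> (k %% 4 = 1 \/ k %% 4 = 3)%N.
Proof. by lia. Qed.

(** Serves to turn upper bounds on fibres into exact sizes once their total is known. *)
Lemma sum_leq_eq (I : finType) (P : pred I) (E1 E2 : I -> nat) :
    (forall i, P i -> (E1 i <= E2 i)%N) ->
    (\sum_(i | P i) E2 i <= \sum_(i | P i) E1 i)%N ->
  forall i, P i -> E1 i = E2 i.
Proof.
move=> le12 le21 i Pi; apply/eqP.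
have /leqif_sum[le_sum] j : P j -> (E1 j <= E2 j ?= iff (E1 j == E2 j))%N.
  by move=> /le12.
by rewrite eqn_leq le_sum le21 => /esym/forall_inP; apply.
Qed.

Lemma card_sum_dep (T U : finType) (A : {set U}) (P : U -> T -> bool) :
  #|[set u : U * T | (u.1 \in A) && P u.1 u.2]|
    = (\sum_(a in A) #|[set b | P a b]|)%N.
Proof.
rewrite -sum1dep_card (eq_bigr (fun a => \sum_(b | P a b) 1)%N); last first.
  by move=> a _; rewrite sum1dep_card.
rewrite pair_big_dep /=; apply: eq_bigl => -[a b] /=.
by rewrite ?inE.
Qed.

Lemma card_fibers (T U : finType) (f : T -> U) (A : {set T}) (B : {set U}) :
    (forall x, x \in A -> f x \in B) ->
  #|A| = (\sum_(c in B) #|[set x in A | f x == c]|)%N.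
Proof.
move=> fB; rewrite -sum1_card (partition_big f (mem B)) //=.
apply: eq_bigr => c _; rewrite -sum1dep_card; by apply: eq_bigl => x.
Qed.

Lemma card_root_le (F : finFieldType) (P : {poly F}) d :
  P != 0 -> (size P <= d.+1)%N -> (#|[set x | root P x]| <= d)%N.
Proof.
move=> nzP szP; rewrite cardE -ltnS (leq_trans _ szP) // max_poly_roots //.
  by apply/allP=> x; rewrite mem_enum inE.
exact: enum_uniq.
Qed.

(** * Fibres of additive maps between finite groups *)

Section AdditiveFibers.
Variables (V W : finZmodType) (f : V -> W) (fD : {morph f : x y / x + y}).

Lemma morphD0 : f 0 = 0.
Proof. by apply: (@addrI _ (f 0)); rewrite -fD !addr0. Qed.

Lemma morphDB x y : f (x - y) = f x - f y.
Proof. by apply: (@addIr _ (f y)); rewrite -fD !subrK. Qed.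

Lemma card_fiber a : #|[set x | f x == f a]| = #|[set x | f x == 0]|.
Proof.
rewrite -(card_imset _ (addIr (- a))); apply: eq_card => x; rewrite inE.
apply/imsetP/eqP => [[y] | fx0].
  by rewrite inE => /eqP fy ->; rewrite morphDB fy subrr.
by exists (x + a); rewrite ?addrK // inE fD fx0 add0r.
Qed.

(* A counting form of the rank formula: upper bounds for the kernel and for
   a set containing the image are attained as soon as their product is #|V|. *)
Lemma additive_fibers (B : {set W}) (a b : nat) :
    (forall x, f x \in B) -> (#|[set x | f x == 0%R]| <= a)%N -> (#|B| <= b)%N ->
    #|V| = (a * b)%N -> (0 < a)%N ->
  #|B| = b /\ forall c, c \in B -> #|[set x | f x == c]| = a.
Proof.
move=> fB le_a le_b oV a_gt0.
have le_fib c : c \in B -> (#|[set x | f x == c]| <= a)%N.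
  move=> _; have [->|[x]] := set_0Vmem [set x | f x == c]; first by rewrite cards0.
  by rewrite inE => /eqP <-; rewrite card_fiber.
have sum_fib : (\sum_(c in B) #|[set x | f x == c]| = a * b)%N.
  rewrite -oV -cardsT (@card_fibers _ _ f _ B) //.
  by apply: eq_bigr => c _; apply: eq_card => x; rewrite !inE.
have oB : #|B| = b.
  apply/eqP; rewrite eqn_leq le_b -(leq_pmul2l a_gt0) -sum_fib mulnC.
  by rewrite -sum_nat_const leq_sum.
split=> //; apply: sum_leq_eq => //.
by rewrite sum_fib sum_nat_const oB mulnC.
Qed.

End AdditiveFibers.

(** * Roots of unity and squares in a finite field *)

Section RootsOfUnity.
Variable F : finFieldType.

Lemma card_pred_gt0 : (0 < #|F|.-1)%N.
Proof. by case: #|F| (finNzRing_gt1 F) => [|[]]. Qed.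

Lemma expf_pred_card (x : F) : x != 0 -> x ^+ #|F|.-1 = 1.
Proof.
move=> nzx; apply: (mulfI nzx); rewrite -exprS mulr1 prednK ?expf_card //.
exact: ltnW (finNzRing_gt1 F).
Qed.

Lemma finField_prim_root : {z : F | #|F|.-1.-primitive_root z}.
Proof.
pose rs := enum [set x : F | x != 0].
have : has #|F|.-1.-primitive_root rs.
  apply: cyclic.has_prim_root card_pred_gt0 _ _ _.
  - apply/allP=> x; rewrite mem_enum inE => nzx; apply/unity_rootP.
    exact: expf_pred_card.
  - exact: enum_uniq.
  rewrite -cardE (_ : [set x | x != 0] = [set~ 0]) ?cardsC1 //.
  by apply/setP=> x; rewrite !inE.
by move=> hz; exists (nth 0 rs (find #|F|.-1.-primitive_root rs)); apply: nth_find.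
Qed.

Lemma card_unity_roots k :
  (k %| #|F|.-1)%N -> #|[set x : F | x ^+ k == 1]| = k.
Proof.
move=> dvk; have [z pz] := finField_prim_root.
have pk := dvdn_prim_root pz dvk.
set w := z ^+ _ in pk.
have inj : injective (fun i : 'I_k => w ^+ i).
  by move=> i j /eqP; rewrite (eq_prim_root_expr pk) !modn_small // => /eqP/val_inj.
rewrite -[RHS]card_ord -(card_imset predT inj) /=; apply: eq_card => x; rewrite inE.
apply/eqP/imsetP => [/(prim_rootP pk)[i ->] | [i _ ->]]; first by exists i.
by rewrite -exprM mulnC exprM (prim_expr_order pk) expr1n.
Qed.

(** Write b = z^i with z a generator of order 2k: then b^k = 1 says that 2k divides ik, so i is
    even. *)
Lemma sqrt_exists (b : F) k :
  #|F|.-1 = (2 * k)%N -> b ^+ k = 1 -> exists a, a ^+ 2 = b.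
Proof.
move=> oF bk1; have [z pz] := finField_prim_root.
have k0 : (0 < k)%N by have := card_pred_gt0; rewrite oF; lia.
have [|[i /= _] bE] := prim_rootP pz (x := b).
  by rewrite oF mulnC exprM bk1 expr1n.
move: bk1; rewrite bE -exprM => /eqP; rewrite -(prim_order_dvd pz) oF.
by rewrite dvdn_pmul2r // => /dvdnP[j ->]; exists (z ^+ j); rewrite exprM.
Qed.

End RootsOfUnity.

(** * The trace as a sum of Frobenius powers *)

Section FrobeniusTrace.
Variables (F : finFieldType) (q n : nat).
Hypotheses (q_pchar : [pchar F].-nat q) (q_gt1 : (1 < q)%N) (oF : #|F| = (q ^ n)%N).

(** The length [m] is free: [m = n] gives the trace of F over F_q, and [m = n/2] will give, on the
    subfield of order q^m, the trace of that subfield. *)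
Definition frobenius_trace (m : nat) (x : F) : F := \sum_(i < m) x ^+ (q ^ i).

(** The copy of F_q inside F, as a plain set, since F carries no chosen subfield here. *)
Definition frobenius_fixed : {set F} := [set x | x ^+ q == x].

Local Notation tr := frobenius_trace.
Local Notation Fix := frobenius_fixed.

Let q_gt0 : (0 < q)%N := ltnW q_gt1.

Lemma frobX_pchar i : [pchar F].-nat (q ^ i)%N.
Proof. by rewrite pnatX q_pchar. Qed.

Lemma frobD i : {morph (fun x : F => x ^+ (q ^ i)) : x y / x + y}.
Proof. by move=> x y; rewrite exprDn_pchar ?frobX_pchar. Qed.

Lemma frobB (x y : F) : (x - y) ^+ q = x ^+ q - y ^+ q.
Proof. exact: (morphDB (frobD 1)). Qed.

Lemma frob_period (x : F) : x ^+ (q ^ n) = x.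
Proof. by rewrite -oF expf_card. Qed.

Lemma ftraceD m : {morph tr m : x y / x + y}.
Proof. by move=> x y; rewrite -big_split; apply: eq_bigr => i _; rewrite frobD. Qed.

Lemma ftrace0 m : tr m 0 = 0.
Proof. exact: morphD0 (ftraceD m). Qed.

Lemma ftraceB m x y : tr m (x - y) = tr m x - tr m y.
Proof. exact: morphDB (ftraceD m) x y. Qed.

Lemma fixedX a i : a \in Fix -> a ^+ (q ^ i) = a.
Proof.
rewrite inE => /eqP aq; elim: i => [|i IH]; first by rewrite expr1.
by rewrite expnS exprM aq.
Qed.

Lemma ftraceZ m a x : a \in Fix -> tr m (a * x) = a * tr m x.
Proof.
move=> aF; rewrite /tr mulr_sumr; apply: eq_bigr => i _.
by rewrite exprMn (fixedX i aF).
Qed.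

Lemma ftrace_fixed m a : a \in Fix -> tr m a = a *+ m.
Proof.
move=> aF; rewrite /tr (eq_bigr (fun=> a)) => [|i _]; last exact: fixedX.
by rewrite sumr_const card_ord.
Qed.

Lemma ftrace_frob x : tr n (x ^+ q) = tr n x.
Proof.
case: n frob_period => [|n' per]; first by rewrite /tr !big_ord0.
rewrite /tr big_ord_recr big_ord_recl /= -exprM -expnS per addrC expr1.
by congr (_ + _); apply: eq_bigr => i _; rewrite -exprM -expnS.
Qed.

(** Transitivity of the trace: the second summand supplies the Frobenius powers of index m to 2m -
    1. *)
Lemma ftrace_split m x : tr m (x + x ^+ (q ^ m)) = tr (2 * m) x.
Proof.
rewrite mulSn mul1n ftraceD /tr big_split_ord /=; congr (_ + _).
by apply: eq_bigr => i _; rewrite -exprM -expnD.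
Qed.

Lemma fixed0 : 0 \in Fix. Proof. by rewrite inE expr0n gtn_eqF. Qed.
Lemma fixed1 : 1 \in Fix. Proof. by rewrite inE expr1n. Qed.
Lemma fixedB a b : a \in Fix -> b \in Fix -> a - b \in Fix.
Proof. by rewrite !inE frobB => /eqP-> /eqP->. Qed.
Lemma fixedN a : a \in Fix -> - a \in Fix.
Proof. by rewrite -sub0r; apply: fixedB fixed0. Qed.
Lemma fixedD a b : a \in Fix -> b \in Fix -> a + b \in Fix.
Proof. by move=> aF bF; rewrite -[b]opprK fixedB ?fixedN. Qed.
Lemma fixedM a b : a \in Fix -> b \in Fix -> a * b \in Fix.
Proof. by rewrite !inE exprMn => /eqP-> /eqP->. Qed.
Lemma fixedV a : a \in Fix -> a^-1 \in Fix.
Proof. by rewrite !inE exprVn => /eqP->. Qed.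
Lemma fixed_nat k : k%:R \in Fix.
Proof. by elim: k => [|k IH]; rewrite ?fixed0 // -natr1 fixedD ?fixed1. Qed.

Lemma ftrace_in x : tr n x \in Fix.
Proof.
rewrite inE; apply/eqP; rewrite -[RHS]ftrace_frob /tr.
rewrite (big_morph (fun y : F => y ^+ q) (frobD 1) (id1 := 0)); last first.
  by rewrite expr0n gtn_eqF.
by apply: eq_bigr => i _; rewrite -!exprM mulnC.
Qed.

Lemma ftrace_frobB_eq0 x : tr n (x ^+ q - x) = 0.
Proof. by rewrite ftraceB ftrace_frob subrr. Qed.

Lemma card_frobX_fixed_le m :
  (0 < m)%N -> (#|[set x : F | x ^+ (q ^ m) == x]| <= q ^ m)%N.
Proof.
move=> m0; pose P : {poly F} := 'X^(q ^ m) - 'X.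
have sP : size P = (q ^ m).+1.
  by rewrite size_polyDl size_polyXn // size_polyN size_polyX ltnS
      (leq_trans q_gt1) // -{1}(expn1 q) leq_exp2l //.
have := @card_root_le _ P (q ^ m); rewrite -size_poly_gt0 sP => /(_ isT (leqnn _)).
by congr (_ <= _)%N; apply: eq_card => x; rewrite !inE rootE /P !hornerE subr_eq0.
Qed.

Lemma card_fixed_le : (#|Fix| <= q)%N.
Proof. exact: (@card_frobX_fixed_le 1). Qed.

Hypothesis n_gt0 : (0 < n)%N.

(** * Exact fibres of the trace and of x^q - x *)

Lemma card_ftrace_ker_le : (#|[set x | tr n x == 0%R]| <= q ^ n.-1)%N.
Proof.
pose P : {poly F} := \sum_(i < n) 'X^(q ^ i).
have sP : size P = (q ^ n.-1).+1.
  rewrite /P; case: (n) n_gt0 => // n' _ /=.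
  rewrite big_ord_recr /= addrC size_polyDl size_polyXn // ltnS.
  apply: leq_trans (size_sum _ _ _) _; apply/bigmax_leqP => i _.
  by rewrite size_polyXn ltn_exp2l.
have := @card_root_le _ P (q ^ n.-1); rewrite -size_poly_gt0 sP => /(_ isT (leqnn _)).
congr (_ <= _)%N; apply: eq_card => x; rewrite !inE rootE /P horner_sum /tr.
by congr (_ == 0); apply: eq_bigr => i _; rewrite hornerXn.
Qed.

(** Both bounds are degrees: q^(n-1) for the kernel polynomial, q for X^q - X. Their product is |F|,
    so both are attained and the trace is onto. *)
Lemma ftrace_fibers :
  #|Fix| = q /\ forall c, c \in Fix -> #|[set x | tr n x == c]| = (q ^ n.-1)%N.
Proof.
have := additive_fibers (ftraceD n) ftrace_in card_ftrace_ker_le card_fixed_le.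
apply.
  by rewrite oF -expnSr prednK.
by rewrite expn_gt0 q_gt0.
Qed.

Lemma card_fixed : #|Fix| = q.
Proof. by case: ftrace_fibers. Qed.

Lemma card_ftrace_fiber c : c \in Fix -> #|[set x | tr n x == c]| = (q ^ n.-1)%N.
Proof. by case: ftrace_fibers => _; apply. Qed.

Definition trace0 : {set F} := [set x | tr n x == 0].

Lemma frobB_D : {morph (fun x : F => x ^+ q - x) : x y / x + y}.
Proof. by move=> x y; rewrite (frobD 1) opprD addrACA. Qed.

(** Additive Hilbert 90 by counting: the kernel of x^q - x is [Fix], and the image lies in [trace0],
    of order at most q^(n-1). *)
Lemma card_frobB_fiber c : tr n c = 0 -> #|[set x : F | x ^+ q - x == c]| = q.
Proof.
move=> trc0.
have [|||||_] := @additive_fibers _ _ _ frobB_D trace0 q (q ^ n.-1).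
- by move=> x; rewrite inE ftrace_frobB_eq0.
- apply: leq_trans card_fixed_le; rewrite leq_eqVlt; apply/orP; left; apply/eqP.
  by apply: eq_card => x; rewrite !inE subr_eq0.
- exact: card_ftrace_ker_le.
- by rewrite oF -expnS prednK.
- exact: q_gt0.
by apply; rewrite inE trc0.
Qed.

Lemma card_frobB_preim (P : pred F) :
  #|[set x : F | P (x ^+ q - x)]| = (q * #|[set y in trace0 | P y]|)%N.
Proof.
rewrite (@card_fibers _ _ (fun x : F => x ^+ q - x) _ [set y in trace0 | P y]).
  rewrite mulnC -sum_nat_const; apply: eq_bigr => c.
  rewrite !inE => /andP[/eqP trc Pc]; rewrite -[RHS](card_frobB_fiber trc).
  by apply: eq_card => x; rewrite !inE andbC; case: eqP => // ->; rewrite Pc.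
by move=> x; rewrite !inE => ->; rewrite ftrace_frobB_eq0 eqxx.
Qed.

Lemma card_trace_mul (a : F) :
  #|[set w | tr n (a * w) == 0]| = if a == 0 then (q ^ n)%N else (q ^ n.-1)%N.
Proof.
case: eqP => [->|/eqP nz] /=.
  by rewrite -oF -cardsT; apply: eq_card => x; rewrite !inE mul0r ftrace0 eqxx.
rewrite -(card_ftrace_fiber fixed0) -[RHS](card_preimset _ (mulfI nz)).
by apply: eq_card => x; rewrite !inE.
Qed.

(** Put v = w^q - w and u = t^q: then tr(u v) = tr((t - t^q) w), whose coefficient vanishes exactly
    when u is in [Fix]. *)
Lemma card_trace0_orth (u : F) :
  (q * #|[set v in trace0 | tr n (u * v)%R == 0%R]|
     = if u \in Fix then q ^ n else q ^ n.-1)%N.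
Proof.
rewrite -(card_frobB_preim (fun v => tr n (u * v) == 0)).
pose t := u ^+ (q ^ n.-1).
have tq : t ^+ q = u by rewrite -exprM -expnSr prednK // frob_period.
have -> : (u \in Fix) = (t - t ^+ q == 0).
  apply/idP/idP => [uF|]; first by rewrite tq /t (fixedX _ uF) subrr eqxx.
  by rewrite subr_eq0 => /eqP tE; rewrite inE -tq -!tE.
rewrite -card_trace_mul; apply: eq_card => w; rewrite !inE.
by rewrite mulrBr mulrBl !ftraceB -{1}tq -exprMn ftrace_frob tq.
Qed.

(** * The second moment of tr(y^2) on the trace zero elements *)

Definition count0 c := #|[set y in trace0 | tr n (y ^+ 2) == c]|.

Definition sqr_pairs := [set u : F * F | [&& u.1 \in trace0, u.2 \in trace0
   & tr n (u.1 ^+ 2) == tr n (u.2 ^+ 2)]].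

Lemma card_sqr_pairs : #|sqr_pairs| = (\sum_(c in Fix) (count0 c ^ 2))%N.
Proof.
rewrite (@card_fibers _ _ (fun u => tr n (u.1 ^+ 2)) _ Fix) => [|u _]; last exact: ftrace_in.
apply: eq_bigr => c _; rewrite -mulnn -cardsX; apply: eq_card => -[y z].
rewrite !inE /=; case: (tr n y == 0); case: (tr n z == 0); rewrite //= ?andbF //.
by rewrite andbC; case: eqP => // ->; rewrite eq_sym.
Qed.

Hypothesis q_odd : odd q.

Lemma nat2_neq0 : 2%:R != 0 :> F.
Proof.
apply/eqP => two0; have two_pchar : 2%N \in [pchar F] by rewrite inE /= two0.
have /p_natP[[|k] qE] : 2%N.-nat q by rewrite -(eq_pnat _ (pcharf_eq two_pchar)).
  by move: q_gt1; rewrite qE.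
by move: q_odd; rewrite qE oddX.
Qed.

Lemma neg1_neq1 : -1 != 1 :> F.
Proof. by rewrite eq_sym -subr_eq0 opprK -(natrD _ 1 1) nat2_neq0. Qed.

Lemma count0_sum : (\sum_(c in Fix) count0 c = q ^ n.-1)%N.
Proof.
rewrite -(card_ftrace_fiber fixed0) (@card_fibers _ _ (fun y => tr n (y ^+ 2)) _ Fix) //.
by move=> y _; apply: ftrace_in.
Qed.

(* (y, z) |-> (y - z, y + z) turns tr(y^2) = tr(z^2) into tr(u v) = 0. *)
Lemma card_sqr_pairs_orth :
  #|sqr_pairs| = (\sum_(u in trace0) #|[set v in trace0 | tr n (u * v)%R == 0%R]|)%N.
Proof.
pose h (u : F * F) := (u.1 - u.2, u.1 + u.2).
have injh : injective h.
  move=> [y z] [y' z'] [/= eB eD]; congr (_, _); apply: (mulfI nat2_neq0).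
    have -> : 2%:R * y = (y - z) + (y + z) by ring.
    by rewrite eB eD; ring.
  have -> : 2%:R * z = (y + z) - (y - z) by ring.
  by rewrite eB eD; ring.
rewrite -(card_sum_dep trace0 (fun u v => (v \in trace0) && (tr n (u * v) == 0))).
rewrite -[RHS](card_preimset _ injh); apply: eq_card => -[y z]; rewrite !inE /=.
rewrite (_ : (y - z) * (y + z) = y ^+ 2 - z ^+ 2); last by ring.
rewrite !ftraceB ftraceD subr_eq0 [in RHS]subr_eq0; case: (tr n (y ^+ 2) == _); rewrite ?andbF //.
rewrite !andbT; apply/andP/andP => [[/eqP-> /eqP->]|[/eqP->]]; first by rewrite addr0.
by rewrite -mulr2n -mulr_natl mulf_eq0 (negPf nat2_neq0).
Qed.

(* [k] is the order of the radical of the form on the trace zero elements. *)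
Lemma count0_variance (k := #|trace0 :&: Fix|) :
  \sum_(c in Fix) (q%:Z * (count0 c)%:Z - (q ^ n.-1)%N%:Z) ^+ 2
    = k%:Z * (q%:Z - 1) * (q ^ n)%N%:Z.
Proof.
have oD : #|trace0| = (q ^ n.-1)%N := card_ftrace_fiber fixed0.
(* Elements of the radical are orthogonal to all of [trace0], the others to a q-th part of it;
   [k * q ^ n.-1] stands on the left to avoid subtraction in nat. *)
have qS : (q * #|sqr_pairs| + k * q ^ n.-1 = k * q ^ n + q ^ n.-1 * q ^ n.-1)%N.
  rewrite card_sqr_pairs_orth big_distrr /=.
  have kD := cardsID Fix trace0; rewrite oD -/k in kD.
  rewrite (bigID (mem Fix)) /=; have -> : (\sum_(u in trace0 | u \in Fix)
      q * #|[set v in trace0 | tr n (u * v)%R == 0%R]| = k * q ^ n)%N.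
    rewrite -sum_nat_const; apply: eq_big => [u|u /andP[_ uF]]; first by rewrite !inE.
    by rewrite card_trace0_orth uF.
  have -> : (\sum_(u in trace0 | u \notin Fix)
      q * #|[set v in trace0 | tr n (u * v)%R == 0%R]|
        = #|trace0 :\: Fix| * q ^ n.-1)%N.
    rewrite -sum_nat_const; apply: eq_big => [u|u /andP[_ uF]]; first by rewrite !inE andbC.
    by rewrite card_trace0_orth (negPf uF).
  by rewrite -addnA -mulnDl [X in (_ + X * _)%N]addnC kD.
have qX : (q ^ n = q * q ^ n.-1)%N by rewrite -expnS prednK.
move: qS count0_sum; rewrite card_sqr_pairs qX; set X := (q ^ n.-1)%N => qS sum0.
have {}sum0 : \sum_(c in Fix) (count0 c)%:Z = X%:Z by rewrite -sum0 (big_morph Posz PoszD (erefl _)).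
rewrite (eq_bigr (fun c => q%:Z ^+ 2 * (count0 c ^ 2)%N%:Z
    - 2 * q%:Z * X%:Z * (count0 c)%:Z + X%:Z ^+ 2)) => [|c _]; last first.
  by rewrite -mulnn PoszM; ring.
rewrite big_split sumrB /= -!mulr_sumr sum0 sumr_const card_fixed.
rewrite -(big_morph Posz PoszD (erefl _)); move: (\sum_(c in Fix) _)%N qS => S qS.
have {}qS : q%:Z * S%:Z = k%:Z * (q%:Z * X%:Z) + X%:Z * X%:Z - k%:Z * X%:Z.
  by apply/eqP; rewrite eq_sym subr_eq eq_sym -!PoszM -!PoszD qS.
rewrite expr2 -[_ * _ * S%:Z]mulrA qS -mulr_natr natz PoszM; ring.
Qed.

(** * From points of the curve to [count0] *)

(** The square expands to (x^2)^q + x^2 - 2 x^(q+1), and (x^2)^q has the same trace as x^2. *)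
Lemma ftrace_sqr_frobB x :
  tr n ((x ^+ q - x) ^+ 2) = - (2%:R * tr n (x ^+ q.+1 - x ^+ 2)).
Proof.
have -> : (x ^+ q - x) ^+ 2 = (x ^+ 2) ^+ q + x ^+ 2 - (x ^+ q.+1 + x ^+ q.+1).
  by rewrite -exprM mulnC exprM (exprS x q); ring.
by rewrite !(ftraceB, ftraceD) ftrace_frob; ring.
Qed.

(** Over a given x there are q values of y if the right-hand side has trace 0, and none otherwise;
    the good x are counted through x^q - x, which gives the second factor q. *)
Lemma card_curve l :
  #|[set P : F * F | P.2 ^+ q - P.2 == P.1 ^+ q.+1 - P.1 ^+ 2 - l]|
    = (q * (q * count0 (- (2%:R * tr n l))))%N.
Proof.
pose rhs (x : F) := x ^+ q.+1 - x ^+ 2 - l.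
have -> : #|[set P : F * F | P.2 ^+ q - P.2 == P.1 ^+ q.+1 - P.1 ^+ 2 - l]|
    = (\sum_(x in [set: F]) #|[set y : F | (y ^+ q - y)%R == rhs x]|)%N.
  rewrite -(card_sum_dep _ (fun x y : F => y ^+ q - y == rhs x)).
  by apply: eq_card => P; rewrite !inE.
rewrite -(card_frobB_preim (fun z => tr n (z ^+ 2) == - (2%:R * tr n l))).
rewrite mulnC -sum_nat_const [RHS](big_mkcond) /=.
apply: eq_big => [x|x _]; first by rewrite !inE.
have -> : (x \in [set x0 | tr n ((x0 ^+ q - x0) ^+ 2) == - (2%:R * tr n l)]) = (tr n (rhs x) == 0).
  rewrite inE ftrace_sqr_frobB eqr_opp (inj_eq (mulfI nat2_neq0)) /rhs.
  by rewrite [tr n (_ - l)]ftraceB subr_eq0.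
case: eqP => [|trc]; first exact: card_frobB_fiber.
apply/eqP; rewrite cards_eq0; apply/set0Pn => -[y]; rewrite inE => /eqP yE.
by case: trc; rewrite -yE ftrace_frobB_eq0.
Qed.

(** * The deviation and its sum of squares *)

Definition deviation c : int := q%:Z * (count0 c)%:Z - (q ^ n.-1)%N%:Z.

(** An element a of [Fix] has trace n a, so the radical is [Fix] when n = 0 in F and is zero
    otherwise. *)
Lemma deviation_sum_sqr :
  \sum_(c in Fix) deviation c ^+ 2
    = (if n%:R == 0 :> F then q%:Z else 1) * (q%:Z - 1) * (q ^ n)%N%:Z.
Proof.
rewrite count0_variance; congr (_ * _ * _).
case: eqP => [n0|/eqP n0].
  rewrite (setIidPr _) ?card_fixed //; apply/subsetP => a aF.
  by rewrite inE ftrace_fixed // -mulr_natr n0 mulr0.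
suff -> : trace0 :&: Fix = [set 0] by rewrite cards1.
apply/setP => a; rewrite !inE; apply/andP/eqP => [[tra aF]|->].
  by move: tra; rewrite ftrace_fixed ?inE // -mulr_natr mulf_eq0 (negPf n0) orbF => /eqP.
by rewrite ftrace0 expr0n gtn_eqF.
Qed.

Let q_ge3 : (2 < q)%N. Proof. by case: q q_gt1 q_odd => [|[|[|]]]. Qed.
Let qn_gt0 : (0 < q ^ n)%N. Proof. by rewrite expn_gt0 q_gt0. Qed.

(** One square is at most the whole sum (q-1) q^n, and q - 1 < (q-1)^2 because q is at least 3. *)
Lemma deviation_sqr_lt c : n%:R != 0 :> F -> c \in Fix ->
  deviation c ^+ 2 < (q%:Z - 1) ^+ 2 * (q ^ n)%N%:Z.
Proof.
move=> n0 cF; have := deviation_sum_sqr; rewrite (negPf n0) (bigD1 c) //=.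
set s := \sum_(_ | _) _; have s0 : 0 <= s by apply: sumr_ge0 => i _; rewrite sqr_ge0.
move: (deviation c ^+ 2) s0 => d s0; move: q_ge3 qn_gt0; move: (q ^ n)%N => N.
move=> q3 N0 dE; nia.
Qed.

Definition count2 c := #|[set y | tr n (y ^+ 2) == c]|.

(* When n = 0 in F, translating y by a fixed element t adds 2 t tr(y) to
   tr(y^2) and does not change tr(y). *)
Lemma card_trace_neq0_leq c c' : n%:R = 0 :> F -> c \in Fix -> c' \in Fix ->
  (#|[set y in ~: trace0 | tr n (y ^+ 2) == c]|
     <= #|[set y in ~: trace0 | tr n (y ^+ 2) == c']|)%N.
Proof.
(* [t y] solves 2 t tr(y) = c' - c. It depends on y only through tr(y), which the translation
   preserves; hence y + t(y) is injective. *)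
move=> n0 cF c'F; pose t y := (c' - c) / (2%:R * tr n y).
have tF y : t y \in Fix by rewrite fixedM ?fixedB ?fixedV ?fixedM ?fixed_nat ?ftrace_in.
have tr_t a : a \in Fix -> tr n a = 0 by move=> aF; rewrite ftrace_fixed // -mulr_natr n0 mulr0.
have trD y : tr n (y + t y) = tr n y by rewrite ftraceD (tr_t _ (tF y)) addr0.
have inj : injective (fun y => y + t y).
  by move=> y z /[dup] /(congr1 (tr n)); rewrite !trD /t => -> /addIr.
rewrite -(card_imset _ inj); apply: subset_leq_card; apply/subsetP => _ /imsetP[y + ->].
rewrite !inE trD => /andP[try /eqP yc]; rewrite try /=.
rewrite (_ : (y + t y) ^+ 2 = y ^+ 2 + (2%:R * t y) * y + t y * t y); last by ring.
rewrite 2!ftraceD yc (ftraceZ _ _ (fixedM (fixed_nat 2) (tF y))).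
rewrite (tr_t _ (fixedM (tF y) (tF y))) addr0 /t; apply/eqP; field.
by rewrite try nat2_neq0.
Qed.

(** Elements of nonzero trace are spread evenly over the values of tr(y^2), say R for each, so T(c)
    = M(c) + R and q^n = q^(n-1) + q R. *)
Lemma deviation_count2 c : n%:R = 0 :> F -> c \in Fix ->
  deviation c = q%:Z * (count2 c)%:Z - (q ^ n)%N%:Z.
Proof.
move=> n0 cF; pose R := #|[set y in ~: trace0 | tr n (y ^+ 2) == c]|.
have c2E : count2 c = (count0 c + R)%N.
  rewrite /count2 -(cardsID trace0); congr (_ + _)%N; apply: eq_card => y;
  by rewrite !inE andbC.
have qR : (q ^ n = q ^ n.-1 + q * R)%N.
  rewrite -oF -(cardsC trace0) (card_ftrace_fiber fixed0); congr (_ + _)%N.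
  rewrite (@card_fibers _ _ (fun y => tr n (y ^+ 2)) _ Fix); last by move=> y _; apply: ftrace_in.
  rewrite -card_fixed -sum_nat_const; apply: eq_bigr => c' c'F.
  by apply/eqP; rewrite eqn_leq !card_trace_neq0_leq.
by rewrite /deviation c2E qR !PoszD PoszM; ring.
Qed.

(** * Odd n with n = 0 in F *)

Section OddDegree.
Hypotheses (n_odd : odd n) (n0 : n%:R = 0 :> F).

(** Either a^q = a or a^q = -a; in the second case a = a^(q^n) = (-1)^n a = -a since q and n are
    odd, so a is fixed again. *)
Lemma sqr_fixed (a : F) : a ^+ 2 \in Fix -> a \in Fix.
Proof.
rewrite !inE -exprM mulnC exprM eqf_sqr => /orP[//|/eqP aq].
have m1q : (-1) ^+ q = -1 :> F by rewrite -signr_odd q_odd.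
have aqX i : a ^+ (q ^ i) = (-1) ^+ i * a.
  elim: i => [|i IH]; first by rewrite mul1r expr1.
  by rewrite expnSr exprM IH exprMn aq exprAC m1q exprS mulrN !mulNr mul1r.
move: (frob_period a); rewrite aqX -signr_odd n_odd expr1 mulN1r => aN.
by rewrite aq aN.
Qed.

(** Otherwise squaring maps [Fix] onto itself, since square roots of fixed elements are fixed; it
    would be injective there, yet 1 and -1 have the same square. *)
Lemma fixed_nonsquare : exists2 g, g \in Fix & forall a : F, a ^+ 2 != g.
Proof.
have [/exists_inP[g gF /forallP]|/exists_inPn noroot] :=
  boolP [exists g in Fix, [forall a, a ^+ 2 != g]]; first by exists g.
have /imset_injP inj : #|[set a ^+ 2 | a in Fix]| == #|Fix|.
  apply/eqP; apply: eq_card => g; apply/imsetP/idP => [[a aF ->]|gF].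
    by rewrite expr2 fixedM.
  have /existsP[a] : [exists a, a ^+ 2 == g].
    by move: (noroot g gF); rewrite negb_forall; under eq_existsb => a do rewrite negbK.
  by move=> /eqP aE; exists a => //; apply: sqr_fixed; rewrite aE.
have /eqP := inj (-1) 1 (fixedN fixed1) fixed1 (sqrrN 1).
by rewrite (negPf neg1_neq1).
Qed.

Definition sqrt_count z := #|[set y : F | y ^+ 2 == z]|.

Lemma sqrt_count_sum : (\sum_z sqrt_count z = #|F|)%N.
Proof.
rewrite -cardsT (@card_fibers _ _ (fun y : F => y ^+ 2) _ setT) //.
by apply: eq_big => z; rewrite ?inE // => _; apply: eq_card => y; rewrite !inE.
Qed.

Lemma sqrt_count_le2 (a : F) : (sqrt_count (a ^+ 2) <= 2)%N.
Proof.
apply: leq_trans (_ : #|[set a; - a]| <= 2)%N; last by rewrite cards2; case: eqP.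
by apply/subset_leq_card/subsetP => y; rewrite !inE eqf_sqr.
Qed.

Lemma sqrt_countP z : sqrt_count z = 0%N \/ exists a, z = a ^+ 2.
Proof.
rewrite /sqrt_count; have [->|[a]] := set_0Vmem [set y : F | y ^+ 2 == z].
  by left; rewrite cards0.
by rewrite inE => /eqP <-; right; exists a.
Qed.

(** The sum is at most 2, as z and g z cannot both be nonzero squares; each term totals |F| over all
    z, so the bound is attained everywhere. *)
Lemma sqrt_count_nonsquare g z : (forall a : F, a ^+ 2 != g) ->
  (sqrt_count z + sqrt_count (g * z)%R = 2)%N.
Proof.
move=> gN; have nz_g : g != 0 by apply: contraNneq (gN 0) => ->; rewrite expr0n.
apply: (@sum_leq_eq _ predT (fun z => sqrt_count z + sqrt_count (g * z)%R)%N
  (fun=> 2)) => // [y _|]; last first.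
  rewrite sum_nat_const big_split /= sqrt_count_sum.
  have -> : (\sum_z sqrt_count (g * z)%R = #|F|)%N.
    by rewrite -sqrt_count_sum [RHS](reindex_inj (mulfI nz_g)).
  by rewrite muln2 addnn.
have [->|nz_y] := eqVneq y 0.
  suff s0 : sqrt_count 0 = 1%N by rewrite mulr0 s0.
  rewrite -(cards1 (0 : F)); apply: eq_card => y0; by rewrite !inE expf_eq0.
have [->|[a aE]] := sqrt_countP y.
  by have [->|[b ->]] := sqrt_countP (g * y); rewrite ?sqrt_count_le2.
have [->|[b bE]] := sqrt_countP (g * y); first by rewrite addn0 aE sqrt_count_le2.
case/eqP: (gN (b / a)); rewrite expr_div_n -bE -aE mulfK //.
Qed.

Lemma count2_sum c : count2 c = (\sum_(z | tr n z == c) sqrt_count z)%N.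
Proof.
rewrite /count2 (@card_fibers _ _ (fun y => y ^+ 2) _ [set z | tr n z == c]).
  apply: eq_big => z; rewrite inE // => /eqP trz.
  by apply: eq_card => y; rewrite !inE andbC; case: eqP => // ->; rewrite trz eqxx.
by move=> y; rewrite !inE.
Qed.

(** Multiplication by g carries the trace fibre of c onto that of g c, and each z in the fibre
    contributes 2. *)
Lemma count2_nonsquare g c : g \in Fix -> (forall a : F, a ^+ 2 != g) ->
  c \in Fix -> (count2 c + count2 (g * c)%R = 2 * q ^ n.-1)%N.
Proof.
move=> gF gN cF; have nz_g : g != 0 by apply: contraNneq (gN 0) => ->; rewrite expr0n.
rewrite !count2_sum [X in (_ + X)%N](reindex_inj (mulfI nz_g)) /=.
rewrite [X in (_ + X)%N](eq_bigl (fun z => tr n z == c)) => [|z]; last first.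
  by rewrite ftraceZ // (inj_eq (mulfI nz_g)).
rewrite -big_split /= (eq_bigr (fun=> 2%N)) => [|z _]; last exact: sqrt_count_nonsquare.
by rewrite -(card_ftrace_fiber cF) -sum1dep_card big_distrr.
Qed.

Lemma count2_square a c : a != 0 -> a ^+ 2 \in Fix -> count2 (a ^+ 2 * c) = count2 c.
Proof.
move=> nz_a aF; rewrite /count2 -[LHS](card_preimset _ (mulfI nz_a)).
apply: eq_card => y; rewrite !inE exprMn ftraceZ //.
by rewrite (inj_eq (mulfI _)) // expf_neq0.
Qed.

Lemma deviation_nonsquare g c : g \in Fix -> (forall a : F, a ^+ 2 != g) ->
  c \in Fix -> deviation (g * c) = - deviation c.
Proof.
move=> gF gN cF; have := count2_nonsquare gF gN cF.
have qX : (q ^ n = q * q ^ n.-1)%N by rewrite -expnS prednK.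
by rewrite !deviation_count2 ?fixedM // qX PoszM => cE; nia.
Qed.

Lemma deviation0_odd : deviation 0 = 0.
Proof.
have [g gF gN] := fixed_nonsquare.
have := deviation_nonsquare gF gN fixed0; rewrite mulr0.
by move: (deviation 0) => d dE; lia.
Qed.

(** The quotient c'/c is a square in F, which leaves T unchanged, or a nonsquare, which flips the
    sign of the deviation. *)
Lemma deviation_sqr_odd c c' : c \in Fix -> c' \in Fix -> c != 0 -> c' != 0 ->
  deviation c' ^+ 2 = deviation c ^+ 2.
Proof.
move=> cF c'F nz_c nz_c'; have gF : c' / c \in Fix by rewrite fixedM ?fixedV.
rewrite -(divfK nz_c c').
have [/existsP[a /eqP aE]|/existsPn gN] := boolP [exists a : F, a ^+ 2 == c' / c].
  rewrite (deviation_count2 n0 (fixedM gF cF)) (deviation_count2 n0 cF) -aE.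
  rewrite count2_square ?aE //.
  by apply: contraNneq (mulf_neq0 nz_c' (invr_neq0 nz_c)) => a0; rewrite -aE a0 expr0n.
by rewrite deviation_nonsquare // sqrrN.
Qed.

(** For c nonzero the sum of squares gives e(c)^2 = q q^n, and q = (q-1)^2 has no integer
    solution. *)
Lemma deviation_sqr_odd_neq c :
  c \in Fix -> deviation c ^+ 2 != (q%:Z - 1) ^+ 2 * (q ^ n)%N%:Z.
Proof.
move=> cF; have [->|nz_c] := eqVneq c 0.
  rewrite deviation0_odd expr0n eq_sym; move: q_ge3 qn_gt0.
  by move: (q ^ n)%N => N q3 N0; nia.
have := deviation_sum_sqr; rewrite n0 eqxx (bigD1 0) ?fixed0 //= deviation0_odd.
rewrite (eq_bigr (fun=> deviation c ^+ 2)) => [|c' /andP[c'F nz_c']]; last first.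
  exact: deviation_sqr_odd.
rewrite sumr_const expr0n add0r.
have -> : #|[pred c' | (c' \in Fix) && (c' != 0)]| = q.-1.
  rewrite -card_fixed (cardsD1 0) fixed0 add1n /=.
  by apply: eq_card => c'; rewrite !inE andbC.
rewrite -mulr_natr natz; move: q_ge3 qn_gt0.
move: (q ^ n)%N (deviation c ^+ 2) => N d q3 N0 dE; apply/eqP => dE'.
have q1 : q.-1%:Z = q%:Z - 1 by lia.
have nz_q1 : q%:Z - 1 != 0 by lia.
have nz_N : N%:Z != 0 by lia.
have /(mulIf nz_N) : (q%:Z - 1) ^+ 2 * N%:Z = q%:Z * N%:Z.
  by rewrite -dE'; apply: (mulIf nz_q1); rewrite q1 in dE; rewrite dE; ring.
nia.
Qed.

End OddDegree.

(** * n = 2m with n = 0 in F *)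

Section EvenDegree.
Variable m : nat.
Hypotheses (n2m : n = (2 * m)%N) (n0 : n%:R = 0 :> F).

Local Notation Q := (q ^ m)%N.
(** [E] is the subfield F_Q, and [h] is the relative trace from F to it. *)
Let E : {set F} := [set x | x ^+ Q == x].
Let h (x : F) := x + x ^+ Q.

Let m_gt0 : (0 < m)%N. Proof. by move: n_gt0; rewrite n2m; case: m. Qed.
Let Q_ge3 : (2 < Q)%N.
Proof. by apply: leq_trans q_ge3 _; rewrite -{1}(expn1 q) leq_exp2l. Qed.
Let oFQ : #|F| = (Q * Q)%N. Proof. by rewrite oF n2m -expnD mul2n addnn. Qed.

Lemma half_period (x : F) : (x ^+ Q) ^+ Q = x.
Proof. by rewrite -exprM -oFQ expf_card. Qed.

Let hD : {morph h : x y / x + y}.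
Proof. by move=> x y; rewrite /h (frobD m) addrACA. Qed.

(** Again by degrees: the kernel consists of roots of X^Q + X, the image of roots of X^Q - X, and Q
    Q = |F|. *)
Lemma h_fibers : #|E| = Q /\ forall c, c \in E -> #|[set x | h x == c]| = Q.
Proof.
have hE x : h x \in E by rewrite inE /h (frobD m) half_period addrC.
have := additive_fibers hD hE; apply => //; last by rewrite ltnW // ltnW.
  pose P : {poly F} := 'X^Q + 'X.
  have sP : size P = Q.+1.
    by rewrite size_polyDl size_polyXn // size_polyX ltnS ltnW.
  have := @card_root_le _ P Q; rewrite -size_poly_gt0 sP => /(_ isT (leqnn _)).
  congr (_ <= _)%N; apply: eq_card => x.
  by rewrite !inE rootE /P !hornerE addrC.
exact: card_frobX_fixed_le.
Qed.

Definition half_count c := #|[set e in E | tr m e == c]|.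

(** The trace of F factors through [h], whose fibres over [E] have Q elements; hence Q times the
    count is q^(n-1). *)
Lemma half_countE c : c \in Fix -> (q * half_count c = Q)%N.
Proof.
move=> cF; have := card_ftrace_fiber cF.
rewrite (@card_fibers _ _ h _ [set e in E | tr m e == c]); last first.
  move=> x; rewrite !inE => trx; rewrite ftrace_split -n2m trx andbT.
  by rewrite /h (frobD m) half_period addrC.
rewrite (eq_bigr (fun=> Q)) => [|e]; last first.
  rewrite inE => /andP[eE /eqP tre]; rewrite -[RHS](proj2 h_fibers e eE).
  apply: eq_card => x; rewrite !inE n2m -ftrace_split andbC.
  by rewrite -/(h x); case: eqP => // ->; rewrite tre eqxx.
rewrite sum_nat_const -/(half_count c) => cE; apply/eqP.
rewrite -(eqn_pmul2r (_ : 0 < Q)%N) ?expn_gt0 ?q_gt0 // -mulnA cE -expnS prednK //.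
by rewrite n2m -expnD mul2n addnn.
Qed.

Definition hsqr_count e := #|[set y | h (y ^+ 2) == e]|.

(** Since Q - 1 divides (Q^2 - 1)/2, e is a square a^2 in F; then y -> a y multiplies h(y^2) by
    e. *)
Lemma hsqr_count1 e : e \in E -> e != 0 -> hsqr_count e = hsqr_count 1.
Proof.
move=> eE nz_e; have Q_odd : odd Q by rewrite oddX q_odd orbT.
have [||a aE] := @sqrt_exists F e (Q.-1 * (Q.+1)./2).
- rewrite oFQ; have := odd_double_half Q.+1; rewrite /= Q_odd; nia.
- rewrite exprM (_ : e ^+ Q.-1 = 1) ?expr1n //; apply: (mulfI nz_e).
  by rewrite -exprS prednK ?expn_gt0 ?q_gt0 // mulr1; move: eE; rewrite inE => /eqP.
have nz_a : a != 0 by apply: contraNneq nz_e => a0; rewrite -aE a0 expr0n.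
rewrite /hsqr_count -(card_preimset _ (mulfI nz_a)); apply: eq_card => y.
rewrite !inE exprMn aE /h exprMn; move: eE; rewrite inE => /eqP ->.
by rewrite -mulrDr -{2}[e]mulr1 (inj_eq (mulfI nz_e)).
Qed.

Lemma hsqr_count_sum : (hsqr_count 0%R + Q.-1 * hsqr_count 1%R = Q * Q)%N.
Proof.
rewrite -oFQ -cardsT (@card_fibers _ _ (fun y => h (y ^+ 2)) _ E); last first.
  by move=> y _; rewrite inE /h (frobD m) half_period addrC.
have E0 : 0 \in E by rewrite inE expr0n gtn_eqF // expn_gt0 q_gt0.
rewrite (bigD1 0) //=; congr (_ + _)%N; first by apply: eq_card => y; rewrite !inE.
rewrite (eq_bigr (fun=> hsqr_count 1)) => [|e /andP[eE nz_e]].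
  rewrite sum_nat_const -(proj1 h_fibers) (cardsD1 0 E) E0 add1n; congr (_ * _)%N.
  by apply: eq_card => e; rewrite [RHS]unfold_in !inE andbC.
by rewrite -(hsqr_count1 eE nz_e); apply: eq_card => y; rewrite !inE.
Qed.

Lemma hsqr_count0E : hsqr_count 0 = #|[set y : F | y ^+ (2 * Q.-1) == -1]|.+1.
Proof.
rewrite /hsqr_count (cardsD1 0) inE /h expr0n add0r expr0n gtn_eqF ?expn_gt0 ?q_gt0 // eqxx add1n.
congr _.+1; apply: eq_card => y; rewrite !inE.
have [->|nz_y] := eqVneq y 0.
  have dgt0 : (0 < 2 * Q.-1)%N by move: Q_ge3; case: Q => [|[]].
  by rewrite /= expr0n gtn_eqF // mulr0n eq_sym oppr_eq0 oner_eq0.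
have -> : y ^+ 2 + (y ^+ 2) ^+ Q = y ^+ 2 * (1 + y ^+ (2 * Q.-1)).
  by rewrite exprM mulrDr mulr1 -exprS prednK ?expn_gt0 ?q_gt0.
by rewrite mulf_eq0 expf_eq0 (negPf nz_y) /= addrC addr_eq0.
Qed.

(** Q^2 - 1 is an odd multiple of 2(Q-1), so y^(2(Q-1)) = -1 would give y^(Q^2-1) = -1; only y = 0
    is left. *)
Lemma hsqr_count0_1mod4 : (Q %% 4 = 1)%N -> hsqr_count 0 = 1%N.
Proof.
move=> Q4; rewrite hsqr_count0E; congr _.+1; apply/eqP; rewrite cards_eq0.
apply/set0Pn => -[y]; rewrite inE => /eqP yE.
have nz_y : y != 0.
  apply: contraTneq (oner_neq0 F) => y0; rewrite -[1]opprK -yE y0 expr0n.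
  by rewrite gtn_eqF ?oppr0 ?eqxx // muln_gt0 /=; lia.
have := expf_pred_card nz_y; rewrite oFQ.
have -> : ((Q * Q).-1 = 2 * Q.-1 * (2 * (Q %/ 4)).+1)%N.
  by have := divn_eq Q 4; rewrite Q4; nia.
rewrite exprM yE -signr_odd /= mul2n odd_double => /eqP.
by rewrite (negPf neg1_neq1).
Qed.

(** With d = 2(Q-1), now 2d divides Q^2 - 1: the solutions of y^d = -1 are the 2d-th roots of unity
    that are not d-th roots, d in number, and y = 0 adds one. *)
Lemma hsqr_count0_3mod4 : (Q %% 4 = 3)%N -> hsqr_count 0 = (2 * Q).-1.
Proof.
move=> Q4; rewrite hsqr_count0E; set d := (2 * Q.-1)%N.
have Fd : (#|F|.-1 = (2 * d) * (Q %/ 4).+1)%N.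
  by rewrite oFQ /d; have := divn_eq Q 4; rewrite Q4; nia.
have dv2 : (2 * d %| #|F|.-1)%N by rewrite Fd dvdn_mulr.
have dv1 : (d %| #|F|.-1)%N by apply: dvdn_trans dv2; apply: dvdn_mull.
have := cardsID [set x : F | x ^+ d == 1] [set x | x ^+ (2 * d) == 1].
rewrite card_unity_roots // (setIidPr _); last first.
  by apply/subsetP => x; rewrite !inE mulnC exprM => /eqP ->; rewrite expr1n.
rewrite card_unity_roots //.
have -> : [set x : F | x ^+ (2 * d) == 1] :\: [set x | x ^+ d == 1] = [set y | y ^+ d == -1].
  apply/setP => x; rewrite !inE mulnC exprM -[in X in _ && X](expr1n _ 2) eqf_sqr.
  by case: eqP => //= ->; rewrite eq_sym (negPf neg1_neq1).
move: #|_| Q_ge3 => X Q3; rewrite /d; lia.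
Qed.

Lemma count2_half c : count2 c = (\sum_(e in [set e in E | tr m e == c]) hsqr_count e)%N.
Proof.
rewrite /count2 (@card_fibers _ _ (fun y => h (y ^+ 2)) _ [set e in E | tr m e == c]).
  apply: eq_bigr => e; rewrite inE => /andP[_ /eqP tre]; apply: eq_card => y.
  rewrite !inE n2m -ftrace_split andbC -/(h (y ^+ 2)).
  by case: eqP => // ->; rewrite tre eqxx.
move=> y; rewrite !inE n2m -ftrace_split => ->.
by rewrite andbT /h (frobD m) half_period addrC.
Qed.

Lemma deviation_even_neq0 c : c \in Fix -> c != 0 ->
  deviation c = q%:Z * (half_count c * hsqr_count 1%R)%N%:Z - (Q * Q)%N%:Z.
Proof.
move=> cF nz_c; rewrite deviation_count2 // -oF oFQ count2_half.
rewrite (eq_bigr (fun=> hsqr_count 1)) ?sum_nat_const // => e.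
rewrite inE => /andP[eE /eqP tre]; apply: hsqr_count1 => //.
by apply: contraNneq nz_c => e0; rewrite -tre e0 ftrace0.
Qed.

Lemma deviation_even0 : deviation 0 =
  q%:Z * (hsqr_count 0%R + (half_count 0%R).-1 * hsqr_count 1%R)%N%:Z - (Q * Q)%N%:Z.
Proof.
rewrite deviation_count2 ?fixed0 // -oF oFQ count2_half.
have E0 : 0 \in [set e in E | tr m e == 0].
  by rewrite !inE expr0n gtn_eqF ?expn_gt0 ?q_gt0 // ftrace0 !eqxx.
rewrite (bigD1 0) //= (eq_bigr (fun=> hsqr_count 1)).
  rewrite sum_nat_const /half_count (cardsD1 0) E0 add1n /=; congr (_ * Posz (_ + _ * _) - _).
  by apply: eq_card => e; rewrite [LHS]unfold_in !inE andbC.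
by move=> e; rewrite inE -andbA => /and3P[eE _ nz_e]; apply: hsqr_count1.
Qed.

Lemma deviation_even c : c \in Fix ->
  deviation c = if (Q %% 4 == 1)%N
    then (if c == 0 then - (q%:Z - 1) * Q%:Z else Q%:Z)
    else (if c == 0 then (q%:Z - 1) * Q%:Z else - Q%:Z).
Proof.
move=> cF; have Q_odd : odd Q by rewrite oddX q_odd orbT.
have qB := half_countE cF; have sumA := hsqr_count_sum.
have B0 : (0 < half_count c)%N by move: Q_ge3; rewrite -qB; case: half_count; rewrite ?muln0.
have qBz : q%:Z * (half_count c)%:Z = Q%:Z by rewrite -PoszM qB.
have B1 : (half_count c).-1%:Z = (half_count c)%:Z - 1 by move: B0; case: half_count => //; lia.
have Q0 : (0 < Q)%N by rewrite ltnW // ltnW.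
have [Q4|Q4] := odd_mod4 Q_odd.
- rewrite Q4 eqxx; have A0 := hsqr_count0_1mod4 Q4.
  (* The remaining Q^2 - 1 elements are shared by Q - 1 nonzero values. *)
  have A1 : hsqr_count 1 = Q.+1.
    apply/eqP; rewrite -(eqn_pmul2l (_ : 0 < Q.-1)%N); last by lia.
    by move: sumA; rewrite A0; lia.
  case: eqP => [c0|/eqP nz_c].
    rewrite c0 in qBz B1 *.
    by rewrite deviation_even0 A0 A1 !(PoszM, PoszD) B1 (intS Q) -qBz; ring.
  by rewrite deviation_even_neq0 // A1 !PoszM (intS Q) -qBz; ring.
rewrite Q4 /=; have A0 := hsqr_count0_3mod4 Q4.
(* Here Q^2 - (2Q - 1) = (Q-1)^2 elements are shared by Q - 1 values. *)
have A1 : hsqr_count 1 = Q.-1.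
  apply/eqP; rewrite -(eqn_pmul2l (_ : 0 < Q.-1)%N); last by lia.
  by move: sumA; rewrite A0; nia.
have Q1 : Q.-1%:Z = Q%:Z - 1 by lia.
have Q2 : (2 * Q).-1%:Z = 2 * Q%:Z - 1 by lia.
case: eqP => [c0|/eqP nz_c].
  rewrite c0 in qBz B1 *.
  by rewrite deviation_even0 A0 A1 !(PoszM, PoszD) Q2 B1 Q1 -qBz; ring.
by rewrite deviation_even_neq0 // A1 !PoszM Q1 -qBz; ring.
Qed.

End EvenDegree.

(** * Necessary conditions for extremality *)

Lemma deviation_extremal c : c \in Fix ->
    deviation c ^+ 2 = (q%:Z - 1) ^+ 2 * (q ^ n)%N%:Z ->
  [/\ c = 0, n%:R = 0 :> F & ~~ odd n].
Proof.
move=> cF dE; have [n0|n0] := eqVneq (n%:R : F) 0; last first.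
  by have := deviation_sqr_lt n0 cF; rewrite dE ltxx.
have [n_odd|n_even] := boolP (odd n).
  by have /eqP := deviation_sqr_odd_neq n_odd n0 cF.
(* For c nonzero in even degree e(c)^2 = Q^2 = q^n, whereas (q-1)^2 > 1. *)
split=> //; apply/eqP/negPn/negP => nz_c.
have n2m : n = (2 * n./2)%N by rewrite mul2n even_halfK.
have Q0 : (0 < q ^ n./2)%N by rewrite expn_gt0 q_gt0.
have := deviation_even n2m n0 cF; rewrite (negPf nz_c) => dQ.
have : deviation c ^+ 2 = (q ^ n./2)%N%:Z ^+ 2 by rewrite dQ; case: ifP => _; rewrite ?sqrrN.
rewrite dE {1}n2m mulnC expnM -mulnn PoszM -expr2.
have nz_Q : (q ^ n./2)%N%:Z ^+ 2 != 0 by rewrite expf_neq0 //; lia.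
by rewrite -[RHS]mul1r => /(mulIf nz_Q); move: q_ge3 => q3; nia.
Qed.

End FrobeniusTrace.

(** * The Galois trace as a Frobenius sum *)

Lemma sum_cycle (R : nmodType) (gT : finGroupType) (x : gT) (f : gT -> R) :
  \sum_(y in <[x]>%g) f y = \sum_(i < #[x]%g) f (x ^+ i)%g.
Proof.
have -> : <[x]>%g = [set (x ^+ (i : 'I_#[x]%g))%g | i in 'I_#[x]%g].
  apply/setP => y; apply/idP/imsetP => [/cyclePmin[i ltix ->]|[i _ ->]].
    by exists (Ordinal ltix).
  exact: mem_cycle.
rewrite big_imset //= => i j _ _ /eqP.
by rewrite cyclic.eq_expg_mod_order !modn_small // => /eqP/val_inj.
Qed.

Lemma card_finvect (K : finFieldType) (L : fieldExtType K) :
  #|finvect_type L| = (#|K| ^ \dim {:L}%VS)%N.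
Proof.
rewrite -(@card_vspace K (finvect_type L) _ (fullv : {vspace finvect_type L})).
by apply: eq_card => x; rewrite memvf.
Qed.

(** The Galois group is cyclic of order dim L, generated by the Frobenius a -> a^|K|. *)
Lemma fftraceE (K : finFieldType) (L : fieldExtType K) (a : finvect_type L) :
  fftrace a = frobenius_trace #|K| (\dim {:L}%VS) a.
Proof.
have [alpha /eqP genE] := galLgen (1%AS : {subfield finvect_type L}).
rewrite dimv1 expn1 => alphaE.
rewrite /fftrace /galTrace genE sum_cycle /frobenius_trace.
have ord_alpha : #[alpha]%g = \dim {:L}%VS.
  by rewrite orderE -genE -galois_dim ?dimv1 ?divn1 // finField_galois ?sub1v.
rewrite ord_alpha; apply: eq_bigr => i _.
have alphaX j : (alpha ^+ j)%g a = a ^+ (#|K| ^ j).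
  elim: j => [|j IH]; first by rewrite gal_id.
  by rewrite expgSr galM ?memvf // IH alphaE -exprM -expnSr.
exact: alphaX.
Qed.

(** * Residues modulo 4 and the classification *)

Lemma expn_mod4 q m : odd q ->
  (q ^ m %% 4 = 1)%N <-> (q %% 4 = 1)%N \/ (q %% 4 = 3)%N /\ ~~ odd m.
Proof.
move=> q_odd; have [q4|q4] := odd_mod4 q_odd.
  by rewrite -modnXm q4 exp1n; split=> //; left.
rewrite -modnXm q4 -{1}(odd_double_half m) -mul2n expnD expnM -modnMmr -modnXm exp1n.
by case: odd; split=> //; [case=> [|[]] | right].
Qed.

Theorem theorem3p8 (p s q n : nat) (K : finFieldType) (L : fieldExtType K)
    (lambda : finvect_type L)
    (p_prime : prime p) (p_odd : odd p) (s_gt0 : (0 < s)%N)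
    (q_def : q = (p ^ s)%N) (n_gt0 : (0 < n)%N)
    (card_K : #|K| = q) (dim_L : \dim {:L}%VS = n) :
  (minimal_curve lambda <->
     [/\ fftrace lambda = 0, (2 * p %| n)%N & q = 1 %[mod 4]] \/
     [/\ fftrace lambda = 0, (4 * p %| n)%N & q = 3 %[mod 4]])
  /\
  (maximal_curve lambda <->
     [/\ fftrace lambda = 0, (2 * p %| n)%N, ~~ (4 %| n)%N & q = 3 %[mod 4]]).
Proof.
rewrite fftraceE card_K dim_L.
pose F : finFieldType := finvect_type L.
have oF : #|F| = (q ^ n)%N.
  by rewrite -card_K -dim_L -card_finvect.
have pF : p \in [pchar F] by apply: (@card_finPcharP _ _ (s * n)); rewrite ?oF ?q_def ?expnM.
have qF : [pchar F].-nat q by rewrite q_def pnatX (eq_pnat _ (pcharf_eq pF)) pnat_id.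
have q_odd : odd q by rewrite q_def oddX p_odd orbT.
have q_gt1 : (1 < q)%N.
  by rewrite q_def (leq_trans (prime_gt1 p_prime)) // -{1}(expn1 p) leq_exp2l ?prime_gt1.
set t := frobenius_trace q n (lambda : F).
have tF : t \in frobenius_fixed F q by apply: ftrace_in.
pose c : F := - (2%:R * t).
have cF : c \in frobenius_fixed F q by rewrite /c fixedN ?fixedM ?fixed_nat.
have c0E : (c == 0) = (t == 0).
  by rewrite oppr_eq0 mulf_eq0 (negPf (nat2_neq0 qF q_gt1 q_odd)).
pose d := @deviation F q n c.
(* [r] is (q-1) q^(n/2), the Hasse-Weil radius divided by q; the point count is q^n + q d. *)
pose r : algC := (q%:R - 1) * sqrtC q%:R ^+ n.
have nz_q : q%:R != 0 :> algC by rewrite pnatr_eq0 -lt0n ltnW.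
have card_pts : #|curve_points lambda|%:R = q%:R ^+ n + q%:R * d%:~R :> algC.
  rewrite /curve_points card_K (card_curve qF q_gt1 oF n_gt0 q_odd) natrM -/c.
  have qX : (q ^ n = q * q ^ n.-1)%N by rewrite -expnS prednK.
  rewrite -natrX qX !natrM rmorphB rmorphM /= -!pmulrn; ring.
have radE : hasse_weil_radius L = q%:R * r.
  by rewrite /hasse_weil_radius card_K dim_L exprD sqrtCK mulrA mulrC.
have minE : minimal_curve lambda <-> d%:~R = - r.
  rewrite /minimal_curve card_pts radE card_K dim_L -mulrN.
  by split=> [/addrI/(mulfI nz_q)|->].
have maxE : maximal_curve lambda <-> d%:~R = r.
  rewrite /maximal_curve card_pts radE card_K dim_L.
  by split=> [/addrI/(mulfI nz_q)|->].
(* Squaring covers both signs and removes the square root of q, so the comparison takes place in the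
   integers. *)
have ext : d%:~R ^+ 2 = r ^+ 2 -> [/\ t = 0, (p %| n)%N & ~~ odd n].
  move=> dr; have [|c0 n0 n_even] := @deviation_extremal F q n qF q_gt1 oF n_gt0 q_odd c cF.
    apply: (@intr_inj algC); rewrite rmorphXn /= dr /r exprMn -exprM mulnC exprM sqrtCK.
    by rewrite rmorphM rmorphXn rmorphB /= -!pmulrn natrX.
  by split=> //; [apply/eqP; rewrite -c0E c0 | rewrite (dvdn_pcharf pF) n0].
have [t0|nz_t] := eqVneq t 0; last first.
  split; [rewrite minE|rewrite maxE]; split=> [dr|].
  - by have [] := ext (_ : _ = _); rewrite ?dr ?sqrrN // => /eqP; rewrite (negPf nz_t).
  - by case=> -[/eqP]; rewrite (negPf nz_t).
  - by have [] := ext (_ : _ = _); rewrite ?dr // => /eqP; rewrite (negPf nz_t).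
  - by case=> /eqP; rewrite (negPf nz_t).
have cop k : coprime (2 ^ k) p by rewrite coprimeXl // coprime2n.
have dv2 : (2 * p %| n)%N = ~~ odd n && (p %| n)%N.
  by rewrite (Gauss_dvd _ (cop 1)) dvdn2.
have dv4 : (4 * p %| n)%N = (4 %| n)%N && (p %| n)%N by rewrite (Gauss_dvd _ (cop 2)).
have [/andP[n_even pn]|nN] := boolP (~~ odd n && (p %| n)%N); last first.
  have dv4N : (4 * p %| n)%N = false.
    by apply: contraNF nN => /(dvdn_trans _) dv; rewrite -dv2 dv // dvdn_mul.
  rewrite dv2 dv4N (negPf nN); split; [rewrite minE|rewrite maxE]; split=> [dr|].
  - by have [] := ext (_ : _ = _); rewrite ?dr ?sqrrN // => _ pn n_even; rewrite n_even pn in nN.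
  - by case=> -[].
  - by have [] := ext (_ : _ = _); rewrite ?dr // => _ pn n_even; rewrite n_even pn in nN.
  - by case.
set m := n./2; have n2m : n = (2 * m)%N by rewrite mul2n even_halfK.
have n0 : n%:R = 0 :> F by apply/eqP; rewrite -(dvdn_pcharf pF).
(* As n is even, [r] is this integer; it is nonzero, so the sign of [d] tells minimal from
   maximal. *)
pose w := (q%:Z - 1) * (q ^ m)%N%:Z.
have dE : d = if (q ^ m %% 4 == 1)%N then - w else w.
  by rewrite /d (deviation_even qF q_gt1 oF n_gt0 q_odd n2m n0 cF) c0E t0 eqxx mulNr.
have rE : r = w%:~R.
  by rewrite /r n2m exprM sqrtCK rmorphM rmorphB /= -!pmulrn natrX.
have wN : (- w == w) = false.
  rewrite eqNr mulf_eq0 subr_eq0 (eqz_nat q 1) eqz_nat !gtn_eqF //.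
  by rewrite expn_gt0 ltnW.
have four_n : (4 %| n)%N = ~~ odd m by rewrite n2m -[4%N]/(2 * 2)%N dvdn_pmul2l // dvdn2.
have min_mod : minimal_curve lambda <-> (q ^ m %% 4 = 1)%N.
  rewrite minE rE -rmorphN /= dE; split=> [/intr_inj|->]; last by rewrite eqxx.
  by case: eqP => // _ /esym/eqP; rewrite wN.
have max_mod : maximal_curve lambda <-> (q ^ m %% 4 <> 1)%N.
  rewrite maxE rE dE; split=> [/intr_inj|/eqP/negPf->] //.
  by case: eqP => // _ /eqP; rewrite wN.
(* It remains to read q^m modulo 4: it is always 1 when q is 1, and when q is 3 it is 1 exactly for
   m even, that is, for 4 dividing n. *)
rewrite min_mod max_mod (expn_mod4 _ q_odd) dv2 dv4 four_n n_even pn t0 /= andbT.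
have q4 := odd_mod4 q_odd.
rewrite (modn_small (isT : 1 < 4)%N) (modn_small (isT : 3 < 4)%N); split; split.
- by case=> [q1|[q3 m_even]]; [left | right].
- by case=> -[_ ? ?]; [left | right].
- move=> nq; split=> //; last by case: q4 => // q1; case: nq; left.
  by apply/negP => m_even; case: nq; case: q4; [left | right].
by case=> _ _ m_odd q3 [q1|[_ m_even]]; [rewrite q1 in q3 | rewrite m_even in m_odd].
Qed.
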